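(* Let $d\ge 2$, let $\Theta=(\theta_{k,\ell})$ be a real antisymmetric $d\times d$ matrix, let $\delta>0$, and let $U=(U_1,\dots,U_d)$ be a $\delta$-almost $\Theta$-commuting unitary tuple on a separable Hilbert space. Then there exists a $\Theta$-commuting unitary $d$-tuple $V_\Theta$ on a separable Hilbert space such that $$\mathrm d_{\mathrm{rD}}(U\to V_\Theta)<(d-1)\sqrt{\delta}.$$
   Context: A unitary tuple $V=(V_1,\dots,V_d)$ is $\Theta$-commuting if $V_\ell V_k=e^{i\theta_{k,\ell}}V_kV_\ell$ for all $k,\ell$. It is $\delta$-almost $\Theta$-commuting if $\|V_\ell V_k-e^{i\theta_{k,\ell}}V_kV_\ell\|\le\delta$ for all $k,\ell$. For operator $d$-tuples on the same space, $\|A-B\|=\max_i\|A_i-B_i\|$; maps are applied entrywise. $C^*(A)$ is the unital C*-algebra generated by $A_1,\dots,A_d$, and $S_A=\mathrm{span}\{1,A_i,A_i^*\}$ is the operator system generated by $A$. The one-sided relaxed dilation distance is $\mathrm d_{\mathrm{rD}}(A\to B)=\inf\|\pi(A)-\Psi(B)\|$, the infimum over all Hilbert spaces $\mathcal L$, all unital faithful $*$-representations $\pi\colon C^*(A)\to B(\mathcal L)$ and all unital completely positive maps $\Psi\colon S_B\to B(\mathcal L)$. *)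

(* Defs.v *)
From HB Require Import structures.
From mathcomp Require Import all_boot all_order all_algebra.
From mathcomp Require Import sesquilinear complex.
From mathcomp Require Import all_classical all_reals all_analysis.

Set Implicit Arguments.
Unset Strict Implicit.
Unset Printing Implicit Defensive.

Import Order.TTheory GRing.Theory Num.Theory.
Import numFieldNormedType.Exports.

Local Open Scope classical_set_scope.
Local Open Scope ring_scope.
Local Open Scope complex_scope.

(* [inner] is linear in its first argument and conjugate-linear in its second. *)
HB.mixin Record isHilbert (R : realType) H & CompleteNormedModule R[i] H := {
  inner : {dot H for Num.conj} ;
  innerE : forall x : H, inner x x = `|x| ^+ 2
}.

#[short(type="hilbertType")]
HB.structure Definition Hilbert (R : realType) :=
  { H of CompleteNormedModule R[i] H & isHilbert R H }.

Definition separable (T : topologicalType) :=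
  exists D : set T, countable D /\ dense D.

Definition expi (R : realType) (t : R) : R[i] := cos t +i* sin t.

(* Operators are plain functions, with the pointwise vector space structure and
   composition [\o] as product; B(H) is carved out of H -> H by [bounded_op]. *)
Section Operators.
Variable R : realType.
Implicit Types H K L : hilbertType R.

Definition bounded_op H : set (H -> H) := [set T | linear T /\ continuous T].

(* The norm of H takes its values in R[i], whence the real part. *)
Definition opnorm H (T : H -> H) : R :=
  sup [set complex.Re `|T x| | x in [set x : H | `|x| <= 1]].

(* S = T^*; for bounded T such an S exists and is unique. *)
Definition adjoint H (T S : H -> H) :=
  forall x y : H, inner (T x) y = inner x (S y).

Definition unitary_op H (U : H -> H) :=
  bounded_op U /\
  exists W : H -> H, [/\ adjoint U W, W \o U = id & U \o W = id].

Definition subspace (V : lmodType R[i]) (M : set V) :=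
  M 0 /\ forall (c : R[i]) (u v : V), M u -> M v -> M (c *: u + v).

Definition unital_cstar_subalgebra H (M : set (H -> H)) :=
  [/\ M `<=` @bounded_op H, subspace M & M id] /\
  [/\ forall S T, M S -> M T -> M (S \o T),
      forall S T, M S -> adjoint S T -> M T &
      forall T, bounded_op T ->
        (forall e : R, 0 < e -> exists2 S, M S & opnorm (T - S) < e) -> M T].

Definition cstar_gen d H (A : 'I_d -> H -> H) : set (H -> H) :=
  smallest (@unital_cstar_subalgebra H) (range A).

Definition opsys_gen d H (A : 'I_d -> H -> H) : set (H -> H) :=
  smallest (@subspace (H -> H))
    ([set id] `|` range A `|` [set S | exists i, adjoint (A i) S]).

Definition linear_on H L (M : set (H -> H)) (f : (H -> H) -> (L -> L)) :=
  forall (c : R[i]) (S T : H -> H), M S -> M T -> f (c *: S + T) = c *: f S + f T.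

(* Maps defined on a subset of B(H) are represented by total functions whose
   values outside that subset are irrelevant. *)
Definition faithful_unital_rep H L (M : set (H -> H))
    (pi : (H -> H) -> (L -> L)) :=
  [/\ forall T, M T -> bounded_op (pi T), linear_on M pi & pi id = id] /\
  [/\ forall S T, M S -> M T -> pi (S \o T) = pi S \o pi T,
      forall S T, M S -> adjoint S T -> adjoint (pi S) (pi T) &
      forall S T, M S -> M T -> pi S = pi T -> S = T].

(* Positivity of the operator on H^n with operator matrix [T]. *)
Definition positive_mx H n (T : 'I_n -> 'I_n -> H -> H) :=
  forall x : 'I_n -> H, 0 <= \sum_(i < n) \sum_(j < n) inner (T i j (x j)) (x i).

Definition ucp H L (M : set (H -> H)) (Psi : (H -> H) -> (L -> L)) :=
  [/\ forall T, M T -> bounded_op (Psi T), linear_on M Psi, Psi id = id &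
      forall n (T : 'I_n -> 'I_n -> H -> H), (forall i j, M (T i j)) ->
        positive_mx T -> positive_mx (fun i j => Psi (T i j))].

Definition tuple_norm d H (A : 'I_d -> H -> H) : R :=
  \big[Num.max/0]_(i < d) opnorm (A i).

(* An extended real, so that the infimum is +oo if there is no pair (pi, Psi). *)
Definition drD d H K (A : 'I_d -> H -> H) (B : 'I_d -> K -> K) : \bar R :=
  ereal_inf [set r | exists (L : hilbertType R) (pi : (H -> H) -> (L -> L))
                            (Psi : (K -> K) -> (L -> L)),
    [/\ faithful_unital_rep (cstar_gen A) pi, ucp (opsys_gen B) Psi &
        r = (tuple_norm (fun i => pi (A i) - Psi (B i)))%:E]].

Definition unitary_tuple d H (V : 'I_d -> H -> H) := forall i, unitary_op (V i).

Definition theta_commuting d H (Theta : 'M[R]_d) (V : 'I_d -> H -> H) :=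
  forall k l, V l \o V k = expi (Theta k l) *: (V k \o V l).

Definition almost_theta_commuting d H (Theta : 'M[R]_d) (delta : R)
    (V : 'I_d -> H -> H) :=
  forall k l,
    opnorm ((V l \o V k) - expi (Theta k l) *: (V k \o V l)) <= delta.

End Operators.

(* Main.v *)
(* Let s = sqrt delta, let N be the integer with N - 1 <= 1/s < N, and write U^n
   for the ordered product U_0^n_0 ... U_(d-2)^n_(d-2), which omits the last
   index.  On K = l2(Z^d; H), the operator V_i with i < d-1 is a translation by
   e_i followed by multiplication with the phase
   p_i(n) = exp (i sum_(j < i) Theta_(j,i) n_j), while V_(d-1) multiplies by
   p_(d-1)(n) and applies U_(d-1) in each fibre.  These operators are exactly
   Theta-commuting.

   The isometry W x = |B|^(-1/2) sum_(n in B) e_n (x) (U^n)^* x, where B is the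
   box [0, N)^d, yields the ucp map Psi(T) = W^* T W, and Psi(V_i) is the
   average over n in B of p_i(n) A_n U_i A_n^*, where A_n is the part of the
   product U^n with indices j < i; for i < d-1 the terms with n_i = 0 are
   missing.  Each almost-commutation moving U_i through a letter U_j costs
   delta, so that ||p_i(n) A_n U_i A_n^* - U_i|| <= delta sum_(j < i) n_j.
   Averaging, we get
   ||Psi(V_i) - U_i|| <= [i < d-1] / N + delta i (N - 1) / 2 < (d - 1) s. *)
Require Import Defs.
From HB Require Import structures.
From mathcomp Require Import all_boot all_order all_algebra sesquilinear complex.
From mathcomp Require Import all_classical all_reals all_analysis.
From mathcomp Require Import finmap ring lra zify.
From mathcomp.analysis Require Import showcase.summability.
Import Order.TTheory GRing.Theory Num.Theory.
Import numFieldNormedType.Exports.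
Local Open Scope ring_scope.
Local Open Scope classical_set_scope.
Local Open Scope complex_scope.

Set Implicit Arguments.
Unset Strict Implicit.
Unset Printing Implicit Defensive.

#[local] Existing Instance totally_filter.

(** * The Hilbert space of square summable families *)

Section InnerProduct.
Variables (R : realType) (H : hilbertType R).
Implicit Types x y z : H.

Lemma inner_ge0 x : 0 <= inner x x. Proof. exact: dnorm_ge0. Qed.

Lemma innerC x y : inner x y = (inner y x)^*%R.
Proof. by rewrite hermC mul1r. Qed.

Lemma innerDl x y z : inner (x + y) z = inner x z + inner y z.
Proof. exact: linearDl. Qed.

Lemma innerDr x y z : inner x (y + z) = inner x y + inner x z.
Proof. exact: linearDr. Qed.

Lemma innerZl (c : R[i]) x y : inner (c *: x) y = c * inner x y.
Proof. exact: linearZl_LR. Qed.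

Lemma innerZr (c : R[i]) x y : inner x (c *: y) = c^*%R * inner x y.
Proof. exact: linearZr_LR. Qed.

Lemma innerNl x y : inner (- x) y = - inner x y.
Proof. exact: linearNl. Qed.

Lemma innerNr x y : inner x (- y) = - inner x y.
Proof. exact: linearNr. Qed.

Lemma inner_polar x y :
  4 * inner x y = inner (x + y) (x + y) - inner (x - y) (x - y) +
   'i%C * inner (x + 'i%C *: y) (x + 'i%C *: y)
   - 'i%C * inner (x - 'i%C *: y) (x - 'i%C *: y).
Proof.
have e : ('i%C : R[i]) * 'i%C = -1 by rewrite -expr2 sqr_i.
rewrite !(innerDl, innerDr, innerNl, innerNr, innerZl, innerZr).
have -> : ('i%C)^*%R = - 'i%C :> R[i] by rewrite complexiE conjCi.
move: (inner x y) (inner y x) (inner x x) (inner y y) => a b c d.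
ring: e.
Qed.
End InnerProduct.

Section CvgLinear.
Variables (K : numFieldType) (V : normedModType K) (T : Type).
Variables (F : set_system T) (FF : Filter F).

Lemma cvg_scaleD (c : K) (f g : T -> V) (a b : V) :
  f @ F --> a -> g @ F --> b -> (fun x => c *: f x + g x) @ F --> c *: a + b.
Proof. by move=> fa gb; apply: cvgD gb; exact: cvgZr. Qed.

Lemma cvg_polar (c d : K) (f1 f2 f3 f4 : T -> V) (a1 a2 a3 a4 : V) :
  f1 @ F --> a1 -> f2 @ F --> a2 -> f3 @ F --> a3 -> f4 @ F --> a4 ->
  (fun x => c *: (f1 x - f2 x + d *: f3 x - d *: f4 x)) @ F -->
  c *: (a1 - a2 + d *: a3 - d *: a4).
Proof.
move=> h1 h2 h3 h4; apply: cvgZr; apply: cvgB; last exact: cvgZr.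
by apply: cvgD; [exact: cvgB|exact: cvgZr].
Qed.
End CvgLinear.

(** * Square summability and the inner product as a limit over finite index sets *)

Section SquareSummable.
Variables (R : realType) (I : choiceType) (H : hilbertType R).
Implicit Types (f g : I -> H) (A B : {fset I}).

Definition psum f g A : R[i]^o := \sum_(i <- A) inner (f i) (g i).

(** In the order of [R[i]], an upper bound of nonnegative numbers is itself real, so this is the
    usual boundedness. *)
Definition square_summable f := exists M : R[i], forall A, psum f f A <= M.

Lemma psum_ge0 f A : 0 <= psum f f A.
Proof. by apply: sumr_ge0 => i _; exact: inner_ge0. Qed.

Lemma psum_mono f A B : (A `<=` B)%fset -> psum f f A <= psum f f B.
Proof.
move=> AB; pose F i := if i \in A then inner (f i) (f i) else 0.
rewrite /psum (eq_big_seq F); last by move=> i iA; rewrite /F iA.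
rewrite (big_fset_incl _ AB); last by move=> i _ iA; rewrite /F (negbTE iA).
by apply: ler_sum => i _; rewrite /F; case: ifP => // _; exact: inner_ge0.
Qed.

(** The partial sums are real, nonnegative and increasing in the finite set, so the net converges to
    the supremum of their real parts. *)
Lemma cvg_psum_diag f : square_summable f ->
  exists l : R[i]^o, [/\ psum f f @ totally --> l,
    forall A, psum f f A <= l & forall M, (forall A, psum f f A <= M) -> l <= M].
Proof.
move=> [M fM]; pose E := range (fun A => complex.Re (psum f f A)).
have psE A : psum f f A = (complex.Re (psum f f A))%:C.
  by rewrite RRe_real// ger0_real// psum_ge0.
have supE : has_sup E.
  split; first by exists (complex.Re (psum f f fset0)), fset0.
  by exists (complex.Re M) => _ [A _ <-]; have := fM A; rewrite lecE => /andP[].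
have le_sup A : complex.Re (psum f f A) <= sup E.
  by apply: (ub_le_sup supE.2); exists A.
exists (sup E)%:C; split=> [|A|N fN]; last 2 first.
- by rewrite psE lecR.
- have /RRe_real NE : N \is Num.real.
    by rewrite ger0_real// (le_trans (psum_ge0 f fset0)).
  rewrite -NE lecR; apply: ge_sup; first exact: supE.1.
  by move=> _ [A _ <-]; rewrite -lecR NE -psE.
apply/cvgrPdist_lt => e e0.
have ee : e = (complex.Re e)%:C by rewrite RRe_real// ger0_real// ltW.
move: e0; rewrite ee ltcR => e0.
have [_ [A _ <-] Ae] := sup_adherent e0 supE.
exists A => //= B AB; rewrite psE -rmorphB/= normc_def/= expr0n/= addr0 sqrtr_sqr.
rewrite ltcR ger0_norm ?subr_ge0//.
have := psum_mono f AB; rewrite lecE => /andP[_ h].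
by rewrite ltrBlDr -ltrBlDl (lt_le_trans Ae h).
Qed.

Lemma square_summableZ (c : R[i]) f :
  square_summable f -> square_summable (c *: f).
Proof.
move=> [M fM]; exists (`|c| ^+ 2 * M) => A.
rewrite /psum (eq_bigr (fun i => `|c| ^+ 2 * inner (f i) (f i))).
  by rewrite -mulr_sumr ler_wpM2l ?exprn_ge0//; exact: fM.
by move=> i _; rewrite innerZl innerZr mulrA -normCK.
Qed.

Lemma square_summableD f g :
  square_summable f -> square_summable g -> square_summable (f + g).
Proof.
move=> [M fM] [N gN]; exists (2 * M + 2 * N) => A.
apply: (@le_trans _ _ (2 * psum f f A + 2 * psum g g A)).
  rewrite /psum !mulr_sumr -big_split/=; apply: ler_sum => i _.
  rewrite -subr_ge0; apply: le_trans (inner_ge0 (f i - g i)) _.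
  rewrite !(innerDl, innerDr, innerNl, innerNr) le_eqVlt.
  by apply/orP; left; apply/eqP; ring.
by apply: lerD; rewrite ler_pM2l.
Qed.

(* Polarization reduces the convergence to that of four monotone nets. *)
Lemma cvg_psum f g : square_summable f -> square_summable g ->
  exists l : R[i]^o, psum f g @ totally --> l.
Proof.
move=> sf sg; have sN h : square_summable h -> square_summable (- h).
  by rewrite -scaleN1r; exact: square_summableZ.
have [l1 [h1 _ _]] := cvg_psum_diag (square_summableD sf sg).
have [l2 [h2 _ _]] := cvg_psum_diag (square_summableD sf (sN _ sg)).
have [l3 [h3 _ _]] := cvg_psum_diag (square_summableD sf (square_summableZ 'i%C sg)).
have [l4 [h4 _ _]] :=
  cvg_psum_diag (square_summableD sf (sN _ (square_summableZ 'i%C sg))).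
have h := @cvg_polar R[i] R[i]^o _ _ _ 4^-1 'i%C _ _ _ _ _ _ _ _ h1 h2 h3 h4.
move: h; set G := (X in X @ _ --> _) => h; eexists.
suff <- : G = psum f g by exact: h.
apply/funext => A; rewrite /G; apply: (@mulfI _ 4); first by rewrite pnatr_eq0.
rewrite -[X in 4 * X = _]/(4^-1 * _) mulrA divff ?pnatr_eq0// mul1r.
rewrite -![_ *: psum _ _ _]/(_ * _) /psum !mulr_sumr -sumrB -big_split/= -sumrB.
by apply: eq_bigr => i _; rewrite inner_polar.
Qed.

Definition l2dot f g : R[i]^o := lim (psum f g @ totally).

Lemma l2dot_lim f g (l : R[i]^o) : psum f g @ totally --> l -> l2dot f g = l.
Proof. by move=> fgl; apply: cvg_lim fgl; exact: norm_hausdorff. Qed.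

Lemma l2dot_cvg f g : square_summable f -> square_summable g ->
  psum f g @ totally --> l2dot f g.
Proof. by move=> sf /(cvg_psum sf)[l fgl]; rewrite (l2dot_lim fgl). Qed.

Lemma l2dotPl (c : R[i]) f f' g : square_summable f -> square_summable f' ->
  square_summable g -> l2dot (c *: f + f') g = c * l2dot f g + l2dot f' g.
Proof.
move=> sf sf' sg; apply: l2dot_lim.
rewrite (_ : psum _ _ = fun A => c *: psum f g A + psum f' g A).
  by apply: (@cvg_scaleD R[i] R[i]^o); exact: l2dot_cvg.
apply/funext => A; rewrite -[c *: psum _ _ _]/(c * _) /psum mulr_sumr -big_split/=.
by apply: eq_bigr => i _; rewrite innerDl innerZl.
Qed.

Lemma l2dotC f g : square_summable f -> square_summable g ->
  l2dot f g = (l2dot g f)^*%R.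
Proof.
move=> sf sg; apply: l2dot_lim; apply/cvgrPdist_lt => e e0.
have /cvgrPdist_lt/(_ _ e0) := l2dot_cvg sg sf.
apply: filterS => A; rewrite (_ : psum f g A = (psum g f A)^*%R).
  by rewrite -rmorphB norm_conjC.
by rewrite /psum rmorph_sum; apply: eq_bigr => i _; rewrite [LHS]innerC.
Qed.

Lemma psum_le_l2dot f A : square_summable f -> psum f f A <= l2dot f f.
Proof. by move=> /cvg_psum_diag[l [/l2dot_lim-> ? _]]. Qed.

Lemma l2dot_le f (M : R[i]) : square_summable f ->
  (forall A, psum f f A <= M) -> l2dot f f <= M.
Proof. by move=> /cvg_psum_diag[l [/l2dot_lim-> _ lM]]; exact: lM. Qed.

Lemma inner_le_l2dot f i : square_summable f -> inner (f i) (f i) <= l2dot f f.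
Proof.
by move=> /psum_le_l2dot => /(_ [fset i]%fset); rewrite /psum big_seq_fset1.
Qed.

Lemma l2dot_finsupp f g A : (forall i, i \notin A -> g i = 0) ->
  l2dot f g = psum f g A.
Proof.
move=> g0; apply: l2dot_lim; apply: cvg_near_cst; exists A => //= B AB.
rewrite /psum; apply/esym/(big_fset_incl _ AB) => i _ /g0 ->.
exact: linear0r.
Qed.

End SquareSummable.

(** * Cauchy-Schwarz and the triangle inequality *)

Section CauchySchwarz.
Variables (C : numClosedFieldType) (U : lmodType C).
Variable form : {dot U for (@Num.conj C)}.

(** This is positivity of the form at [u - c *: v], where [c *: v] is the orthogonal projection of
    [u] onto the line of [v]. *)
Lemma dot_CauchySchwarz u v : `|form u v| ^+ 2 <= form u u * form v v.
Proof.
have [->|v0] := eqVneq v 0.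
  by rewrite (linear0r form u) normr0 expr0n/= mulr_ge0// dnorm_ge0.
have vv0 : 0 < form v v by rewrite dnorm_gt0.
have vvR : (form v v)^*%R = form v v by rewrite conj_Creal// gtr0_real.
pose c := form u v / form v v.
have cu : c^*%R * form u v = `|form u v| ^+ 2 / form v v.
  by rewrite rmorphM/= fmorphV/= vvR normCK; ring.
have := dnorm_ge0 form (u - c *: v).
rewrite dnormB dnormZ linearZr_LR/= cu rmorphM/= fmorphV/= vvR.
rewrite [in X in _ - (_ + X)]normCK rmorphM/= conjCK [_^*%R * _]mulrC -normCK.
rewrite normrM exprMn normfV (gtr0_norm vv0).
rewrite (_ : _ + _ - _ = form u u - `|form u v| ^+ 2 / form v v).
  by rewrite subr_ge0 ler_pdivrMr.
by field; rewrite gt_eqF.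
Qed.

(** Stated for a bare dot product, because it supplies the norm of [l2] before [l2] is known to be a
    Hilbert space. *)
Lemma dot_triangle u v :
  sqrtC (form (u + v) (u + v)) <= sqrtC (form u u) + sqrtC (form v v).
Proof.
rewrite -ler_sqr ?nnegrE ?addr_ge0 ?sqrtC_ge0 ?dnorm_ge0//.
rewrite sqrrD !sqrtCK addrAC dnormD lerD2l.
rewrite -sqrtCM ?nnegrE ?dnorm_ge0//.
apply: (@le_trans _ _ (`|form u v| *+ 2)).
  rewrite mulr2n -{2}norm_conjC.
  apply: le_trans (ler_normD _ _).
  by rewrite real_ler_norm// CrealE rmorphD/= conjCK addrC.
rewrite lerMn2r/= -[X in X <= _](sqrCK (normr_ge0 _)).
rewrite ler_sqrtC ?nnegrE ?exprn_ge0 ?mulr_ge0 ?dnorm_ge0//.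
exact: dot_CauchySchwarz.
Qed.

End CauchySchwarz.

(** * The normed space of square summable families *)

Section L2Space.
Variables (R : realType) (I : choiceType) (H : hilbertType R).

Definition square_summableb : {pred I -> H} := fun f => `[< square_summable f >].

Record l2 := L2 { l2val :> I -> H ; _ : l2val \in square_summableb }.

HB.instance Definition _ := [isSub for l2val].
HB.instance Definition _ := [Choice of l2 by <:].

Lemma l2P (f : l2) : square_summable f.
Proof. exact/asboolP/(valP f). Qed.

Lemma square_summable_submod_closed : submod_closed square_summableb.
Proof.
split=> [|c f g].
  apply/asboolP; exists 0 => A.
  by rewrite /psum big1// => i _; exact: linear0r.
move=> /asboolP sf /asboolP sg; apply/asboolP.
by apply: square_summableD => //; apply: square_summableZ.
Qed.

HB.instance Definition _ :=
  GRing.isSubmodClosed.Build R[i] (I -> H) square_summableb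
    square_summable_submod_closed.

HB.instance Definition _ := [SubChoice_isSubLmodule of l2 by <:].

Definition l2form (f g : l2) : R[i] := l2dot f g.

Lemma l2form_hermitian f g : l2form f g = (-1) ^+ false * (l2form g f)^*%R.
Proof. by rewrite mul1r; apply: l2dotC; exact: l2P. Qed.

Lemma l2form_bilinear : bilinear_for
  (GRing.Scale.Law.clone _ _ *%R _)
  (GRing.Scale.Law.clone _ _ (Num.conj \; *%R) _)
  l2form.
Proof.
split=> [g|g] c f f' /=.
- by apply: l2dotPl; exact: l2P.
rewrite ![l2form g _]l2form_hermitian !mul1r -rmorphM -rmorphD; congr Num.conj.
by apply: l2dotPl; exact: l2P.
Qed.

Lemma l2form_gt0 f : f != 0 -> 0 < l2form f f.
Proof.
move=> f0; have [i fi0] : exists i, l2val f i != 0.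
  apply: contra_notP (negP f0) => fi0; apply/eqP/val_inj/funext => i /=.
  by apply: contra_notP fi0 => /eqP ?; exists i.
apply: lt_le_trans (inner_le_l2dot i (l2P f)).
exact: neq0_dnorm_gt0.
Qed.

HB.instance Definition _ :=
  bilinear_isBilinear.Build R[i] l2 l2 R[i] *%R (Num.conj \; *%R) l2form
    l2form_bilinear.
HB.instance Definition _ := isHermitianSesquilinear.Build R[i] l2 false Num.conj
  l2form l2form_hermitian.
HB.instance Definition _ := isDotProduct.Build R[i] l2 l2form l2form_gt0.

Definition l2norm (f : l2) : R[i] := sqrtC (l2form f f).

Lemma l2normD f g : l2norm (f + g) <= l2norm f + l2norm g.
Proof. exact: (@dot_triangle _ l2 l2form). Qed.

Lemma l2normZ (c : R[i]) f : l2norm (c *: f) = `|c| * l2norm f.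
Proof.
rewrite /l2norm (@dnormZ _ _ l2form) sqrtCM ?nnegrE ?exprn_ge0//.
by rewrite sqrCK.
Qed.

Lemma l2norm0_eq0 f : l2norm f = 0 -> f = 0.
Proof. by move/eqP; rewrite sqrtC_eq0 (@dnorm_eq0 _ _ l2form) => /eqP. Qed.

HB.instance Definition _ :=
  Lmodule_isNormed.Build R[i] l2 l2normD l2normZ l2norm0_eq0.

End L2Space.

Section L2Norm.
Variables (R : realType) (I : choiceType) (H : hilbertType R).
Local Notation l2 := (l2 I H).

Lemma l2form_norm (f : l2) : l2form f f = `|f| ^+ 2.
Proof. by rewrite sqrtCK. Qed.

Lemma inner_norm (K : hilbertType R) (x : K) : inner x x = `|x| ^+ 2.
Proof. exact: innerE. Qed.

Lemma norm_le_l2norm (f : l2) i : `|l2val f i| <= `|f|.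
Proof.
rewrite -ler_sqr ?nnegrE// -inner_norm -l2form_norm.
exact/inner_le_l2dot/l2P.
Qed.

Lemma l2norm_le (f : l2) (M : R[i]) : 0 <= M ->
  (forall A, psum f f A <= M ^+ 2) -> `|f| <= M.
Proof.
move=> M0 fM; rewrite -ler_sqr ?nnegrE// -l2form_norm.
exact/l2dot_le/fM/l2P.
Qed.

End L2Norm.

(** * Completeness of [l2] *)

Section CvgSumSquares.
Variables (K : numFieldType) (V : normedModType K) (T : Type) (J : Type).
Variables (F : set_system T) (FF : ProperFilter F).

Lemma cvg_sum_sqr_norm (u : T -> J -> V) (g : J -> V) (s : seq J) :
  (forall j, u^~ j @ F --> g j) ->
  ((fun t => \sum_(j <- s) `|u t j| ^+ 2 : K^o) @ F -->
    (\sum_(j <- s) `|g j| ^+ 2 : K^o)).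
Proof.
move=> ug; elim: s => [|j s IH].
  under eq_fun do rewrite big_nil.
  by rewrite big_nil; exact: cvg_cst.
under eq_fun do rewrite big_cons.
rewrite big_cons; apply: cvgD => //.
under eq_fun do rewrite expr2.
by rewrite expr2; apply: cvgM; exact: cvg_norm.
Qed.

(** A finite form of Fatou's lemma: the sums converge, and a limit above [M] would force nearby sums
    above [M]. *)
Lemma sum_sqr_norm_lim_le (u : T -> J -> V) (g : J -> V) (s : seq J) (M : K) :
  (forall j, u^~ j @ F --> g j) ->
  (\forall t \near F, \sum_(j <- s) `|u t j| ^+ 2 <= M) ->
  \sum_(j <- s) `|g j| ^+ 2 <= M.
Proof.
move=> ug uM; have S0 (h : J -> V) : 0 <= \sum_(j <- s) `|h j| ^+ 2.
  by apply: sumr_ge0 => j _; exact: exprn_ge0.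
have [t0 /= t0M] := filter_ex uM.
(* The order of [K] is only partial, so [M] must be real before the inequality can be negated. *)
have MR : M \is Num.real by rewrite ger0_real// (le_trans _ t0M).
rewrite real_leNgt ?(ger0_real (S0 _))//; apply/negP => Ml.
have /cvgrPdist_lt/(_ _ _)-/(_ (\sum_(j <- s) `|g j| ^+ 2 - M)) :=
  cvg_sum_sqr_norm (s := s) ug.
rewrite subr_gt0 => /(_ Ml) h.
have [t /= [tM th]] := filter_ex (filterI uM h).
have := le_lt_trans (real_ler_norm _) th.
rewrite rpredB ?(ger0_real (S0 _))// => /(_ isT).
by rewrite ltrD2l ltrN2 => /(le_lt_trans tM); rewrite ltxx.
Qed.

End CvgSumSquares.

Section L2Complete.
Variables (R : realType) (I : choiceType) (H : hilbertType R).
Local Notation l2 := (l2 I H).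

(** Coordinates are 1-Lipschitz, so a Cauchy filter converges coordinatewise to some [g]. Passing to
    the limit in finite partial sums bounds [g - x] for every centre [x] of a ball in the filter;
    this yields both that [g] is square summable and that the filter converges in norm. *)
Lemma l2_complete (F : set_system l2) : ProperFilter F -> cauchy F -> cvg F.
Proof.
move=> FF /cauchyP FC.
pose Fi i := (fun f : l2 => l2val f i) @ F.
have Fi_cvg i : cvg (Fi i).
  apply: cauchy_cvg; apply/cauchy_exP => e e0.
  have [x xF] := FC _ e0; exists (l2val x i).
  suff : F (fun f : l2 => ball (l2val x i) e (l2val f i)) by [].
  apply: filterS xF => f.
  rewrite -!ball_normE/=; apply: le_lt_trans.
  exact: (norm_le_l2norm (x - f) i).
pose g i := lim (Fi i).
have gP (x : l2) (e : R[i]) : 0 < e -> F (ball x e) -> forall A,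
    psum (g - l2val x) (g - l2val x) A <= e ^+ 2.
  move=> e0 xF A.
  rewrite /psum; under eq_bigr do rewrite inner_norm.
  apply: (@sum_sqr_norm_lim_le _ H _ _ F _ (fun f i => l2val f i - l2val x i)).
    by move=> j; apply: cvgB; [exact: Fi_cvg|exact: cvg_cst].
  near=> f.
  have xf : ball x e f by near: f.
  have := psum_le_l2dot A (l2P (f - x)).
  rewrite /psum; under eq_bigr do rewrite inner_norm.
  move=> /le_trans; apply.
  rewrite [leLHS]l2form_norm ler_sqr ?nnegrE// ?ltW//.
  by move: xf; rewrite -ball_normE/= distrC.
have gl2 : g \in @square_summableb R I H.
  have [x xF] := FC _ ltr01.
  rewrite -(subrK (l2val x) g); apply/asboolP/square_summableD; last exact: l2P.
  by exists (1 ^+ 2) => A; exact: gP.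
pose G : l2 := L2 gl2.
have FG : F --> G.
  apply/cvgrPdist_le => e e0.
  have e20 : 0 < e / 2 by rewrite divr_gt0.
  have [x xF] := FC _ e20; near=> f.
  have xf : ball x (e / 2) f by near: f.
  rewrite -(subrK x G) -addrA (splitr e).
  apply: le_trans (ler_normD _ _) _; apply: lerD.
    apply: l2norm_le (ltW e20) _ => A.
    exact: (gP x).
  by move: xf; rewrite -ball_normE/= => /ltW.
exact: cvgP FG.
Unshelve. all: by end_near.
Qed.

HB.instance Definition _ := Uniform_isComplete.Build l2 l2_complete.

HB.instance Definition _ := isHilbert.Build R l2 (@l2form_norm R I H).

End L2Complete.

Lemma norm_pythagoras (R : realType) (H : hilbertType R) (x y : H) :
  inner x y = 0 -> `|x + y| ^+ 2 = `|x| ^+ 2 + `|y| ^+ 2.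
Proof.
move=> xy; rewrite -!inner_norm !innerDl !innerDr xy (innerC y) xy conjC0.
by rewrite addr0 add0r.
Qed.

(** * Truncation to finite sets and separability of [l2] *)

Section FiniteSupport.
Variables (R : realType) (I : choiceType) (H : hilbertType R).
Local Notation l2 := (l2 I H).

Lemma square_summable_fin (A : {fset I}) (u : I -> H) :
  (fun i => if i \in A then u i else 0) \in @square_summableb R I H.
Proof.
apply/asboolP; exists (psum u u A) => B.
apply: le_trans (psum_mono _ (fsubsetUr A B)) _.
rewrite /psum le_eqVlt; apply/orP; left; apply/eqP/esym.
rewrite (eq_big_seq (fun i => inner (if i \in A then u i else 0)
  (if i \in A then u i else 0))); last by move=> i ->.
apply: (big_fset_incl _ (fsubsetUl A B)) => i _ /negbTE ->.
exact: linear0r.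
Qed.

Definition l2fin A u : l2 := L2 (square_summable_fin A u).

Lemma l2form_finr (f : l2) A u : l2form f (l2fin A u) = psum f u A.
Proof.
rewrite /l2form (@l2dot_finsupp _ _ _ _ _ A); last by move=> i /negbTE /= ->.
by apply: eq_big_seq => i /= ->.
Qed.

Lemma l2fin_sqr_norm A u : `|l2fin A u| ^+ 2 = \sum_(i <- A) `|u i| ^+ 2.
Proof.
rewrite -l2form_norm l2form_finr; apply: eq_big_seq => i /= ->.
exact: inner_norm.
Qed.

(** Truncation and remainder have disjoint supports, hence are orthogonal, and Pythagoras
    applies. *)
Lemma l2fin_tail (f : l2) A :
  `|f - l2fin A f| ^+ 2 = `|f| ^+ 2 - \sum_(i <- A) `|l2val f i| ^+ 2.
Proof.
have fA : l2form (f - l2fin A f) (l2fin A f) = 0.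
  rewrite l2form_finr /psum big_seq big1// => i iA.
  have -> : l2val (f - l2fin A f) i = 0
    by rewrite -[LHS]/(l2val f i - (if i \in A then l2val f i else 0)) iA subrr.
  exact: linear0l.
rewrite -[in `|f| ^+ 2](subrK (l2fin A f) f) (norm_pythagoras fA).
by rewrite (l2fin_sqr_norm A f) addrK.
Qed.

Lemma l2fin_approx (f : l2) (e : R[i]) : 0 < e ->
  exists A, `|f - l2fin A f| < e.
Proof.
move=> e0; have e20 : 0 < e ^+ 2 by rewrite exprn_gt0.
have /cvgrPdist_lt/(_ _ e20)[A _ /(_ A (fsubset_refl _))] :=
  l2dot_cvg (l2P f) (l2P f).
rewrite -[l2dot f f]/(l2form f f) l2form_norm /psum.
under eq_bigr do rewrite inner_norm.
rewrite -l2fin_tail ger0_norm ?exprn_ge0// ltr_pXn2r// ?nnegrE ?(ltW e0)//.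
by exists A.
Qed.

End FiniteSupport.

Lemma separable_dense_seq (R : realType) (H : hilbertType R) : separable H ->
  exists h : nat -> H, forall x (e : R[i]), 0 < e -> exists n, `|x - h n| < e.
Proof.
move=> [D [/pcard_surjP[h hD] dD]]; exists h => x e e0.
have [|y [+ Dy]] := dD (ball x e) _ (ball_open x e).
  by exists x; exact: ballxx.
rewrite -ball_normE/= => xy.
by have [n _ ny] := hD _ Dy; exists n; rewrite ny.
Qed.

(** The countable dense set consists of the finitely supported families with values in a dense
    sequence of [H], coded by the support and a list of positions in that sequence. *)
Lemma l2_separable (R : realType) (I : countType) (H : hilbertType R) :
  separable H -> separable (l2 I H).
Proof.
move=> /separable_dense_seq[h hD].
pose q (c : {fset I} * seq nat) : l2 I H :=
  l2fin c.1 (fun i => h (nth 0 c.2 (index i (enum_fset c.1)))).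
exists (range q); split.
  exact: card_le_trans (card_image_le q setT) (countableP _).
move=> O [f Of] oO.
have /nbhs_ballP[e /= e0 feO] : nbhs f O by apply: open_nbhs_nbhs.
have e20 : 0 < e / 2 by rewrite divr_gt0.
have [A fA] := l2fin_approx f e20.
(* The successor keeps [N] positive when [A] is empty; the sum of [r ^+ 2] over [A] still stays
   below [(e / 2) ^+ 2]. *)
pose N : R[i] := (size (enum_fset A)).+1%:R.
have N0 : 0 < N by rewrite ltr0n.
pose r := e / 2 / N.
have r0 : 0 < r by rewrite divr_gt0.
have [k hk] := choice (fun i => hD (l2val f i) r r0).
exists (q (A, map k (enum_fset A))); split; last by exists (A, map k (enum_fset A)).
apply: feO; rewrite -ball_normE/=.
rewrite (_ : q _ = l2fin A (h \o k)); last first.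
  apply/val_inj/funext => i /=; case: ifP => // iA.
  by rewrite (nth_map i) ?index_mem// nth_index.
rewrite -(subrK (l2fin A f) f) -addrA (splitr e).
apply: le_lt_trans (ler_normD _ _) _; apply: ltr_leD => //.
rewrite -ler_sqr ?nnegrE ?(ltW e20)//.
rewrite (_ : _ - _ = l2fin A (fun i => l2val f i - h (k i))); last first.
  apply/val_inj/funext => i; rewrite -[LHS]/((if i \in A then l2val f i else 0)
    - (if i \in A then h (k i) else 0)) /=.
  by case: ifP => // _; rewrite subrr.
rewrite l2fin_sqr_norm.
apply: (@le_trans _ _ (\sum_(i <- A) r ^+ 2)).
  by apply: ler_sum => i _; rewrite ler_sqr ?nnegrE ?(ltW r0)// ltW.
rewrite big_const_seq count_predT iter_addr_0 -[leLHS]mulr_natr.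
rewrite /r; move: (e / 2) e20 => a a0.
rewrite expr_div_n [_ / _ * _]mulrAC ler_pdivrMr ?exprn_gt0//.
rewrite ler_pM2l ?exprn_gt0// /N -natrX ler_nat.
by rewrite -mulnn; nia.
Qed.

(** * Bounded operators on a Hilbert space *)

(** Turns the predicate [linear] into a bundled map, to which the lemmas on linear maps apply. *)
Lemma linear_pack (K : nzRingType) (V W : lmodType K) (T : V -> W) :
  linear T -> exists f : {linear V -> W}, T = f.
Proof.
move=> lT; pose M := GRing.isLinear.Build K V W _ T lT.
by exists (HB.pack_for {linear V -> W} T M).
Qed.

Section BoundedLinear.
Variables (K : numFieldType) (V W : normedModType K) (T : V -> W).

Lemma lipschitz_continuous (M : K) : 0 <= M -> linear T ->
  (forall x, `|T x| <= M * `|x|) -> continuous T.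
Proof.
move=> M0 /linear_pack[f ->] fM; apply: bounded_linear_continuous.
apply/linear_boundedP; near=> r => x.
apply: le_trans (fM x) _; apply: ler_wpM2r => //.
by near: r; apply: nbhs_pinfty_ge; rewrite ger0_real.
Unshelve. all: by end_near. Qed.

Lemma continuous_lipschitz : linear T -> continuous T ->
  exists2 M : K, 0 < M & forall x, `|T x| <= M * `|x|.
Proof.
move=> /linear_pack[f ->] /(_ 0) /(continuous_linear_bounded 0)/linear_boundedP.
move=> fM; near (pinfty_nbhs K) => M; exists M; first by near: M; exact: nbhs_pinfty_gt.
by near: M.
Unshelve. all: by end_near. Qed.

End BoundedLinear.

Section HilbertOperators.
Variables (R : realType) (H : hilbertType R).
Implicit Types (x y z : H) (S T : H -> H).

Lemma inner_inj y z : (forall x, inner x y = inner x z) -> y = z.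
Proof.
move=> yz; apply/eqP; rewrite -subr_eq0 -normr_eq0 -sqrf_eq0 -inner_norm.
by rewrite innerDr innerNr yz subrr.
Qed.

Lemma inner_le_norm x y : `|inner x y| <= `|x| * `|y|.
Proof.
rewrite -ler_sqr ?nnegrE ?mulr_ge0// exprMn -!inner_norm.
exact: dot_CauchySchwarz.
Qed.

Lemma adjoint_linear S T : adjoint S T -> linear T.
Proof.
move=> ST c x y; apply: inner_inj => z.
by rewrite innerDr innerZr -!ST innerDr innerZr.
Qed.

(** If [M] bounds [S], then [|T y|^2 = <S (T y), y> <= M |T y| |y|]. *)
Lemma adjoint_bounded S T : bounded_op S -> adjoint S T -> bounded_op T.
Proof.
move=> [lS cS] ST; have lT := adjoint_linear ST; split=> //.
have [M M0 SM] := continuous_lipschitz lS cS.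
apply: (@lipschitz_continuous _ _ _ _ M (ltW M0)) => // y.
have [->|Ty0] := eqVneq (T y) 0; first by rewrite normr0 mulr_ge0// ltW.
have Ty_gt0 : 0 < `|T y| by rewrite normr_gt0.
rewrite -(ler_pM2r Ty_gt0) -expr2 -inner_norm -ST.
rewrite -[leLHS]ger0_norm; last by rewrite ST inner_ge0.
apply: le_trans (inner_le_norm _ _) _.
by rewrite mulrAC; apply: ler_wpM2r => //; exact: SM.
Qed.

Lemma bounded_op_subspace : Defs.subspace (@bounded_op R H).
Proof.
split.
  by split=> [c x y|]; [rewrite /= scaler0 addr0|exact: cst_continuous].
move=> c S T [lS cS] [lT cT]; split.
  move=> a x y; rewrite /= !fctE lS lT !scalerDr !scalerA [c * a]mulrC.
  by rewrite addrACA.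
by move=> x; apply: cvgD; [apply: cvgZr; exact: cS|exact: cT].
Qed.

Lemma bounded_op_comp S T : bounded_op S -> bounded_op T -> bounded_op (S \o T).
Proof.
move=> [lS cS] [lT cT]; split; first by move=> a x y; rewrite /= lT lS.
by move=> x; apply: continuous_comp; [exact: cT|exact: cS].
Qed.

Lemma bounded_op_id : bounded_op (@id H).
Proof. by split=> // x; exact: cvg_id. Qed.

(** Makes the set of all bounded operators one of those intersected in [cstar_gen], so that
    generated algebras consist of bounded operators. *)
Lemma bounded_op_cstar_subalgebra : unital_cstar_subalgebra (@bounded_op R H).
Proof.
split; split=> //.
- exact: bounded_op_subspace.
- exact: bounded_op_id.
- by move=> S T; exact: bounded_op_comp.
- by move=> S T; exact: adjoint_bounded.
Qed.

Lemma cstar_gen_bounded d (A : 'I_d -> H -> H) :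
  (forall i, bounded_op (A i)) -> cstar_gen A `<=` @bounded_op R H.
Proof.
move=> bA T; apply; split; first exact: bounded_op_cstar_subalgebra.
by move=> _ [i _ <-].
Qed.

Lemma opsys_gen_bounded d (A : 'I_d -> H -> H) :
  (forall i, bounded_op (A i)) -> opsys_gen A `<=` @bounded_op R H.
Proof.
move=> bA T; apply; split; first exact: bounded_op_subspace.
move=> S [[->|[i _ <-]//]|[i AS]]; first exact: bounded_op_id.
exact: adjoint_bounded AS.
Qed.

Lemma opnorm_le T (r : R) : 0 <= r -> (forall x, `|T x| <= r%:C * `|x|) ->
  opnorm T <= r.
Proof.
move=> r0 Tr; apply: ge_sup.
  by exists (complex.Re `|T 0|), 0 => //=; rewrite normr0 ler01.
move=> _ [x /= x1 <-].
have : `|T x| <= r%:C.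
  by apply: le_trans (Tr x) _; rewrite ler_piMr// ler0c.
by rewrite lecE => /andP[].
Qed.

(** The bound [M] makes [opnorm T] a genuine supremum instead of a default value of [sup]; then [x]
    is normalized. *)
Lemma le_opnorm T (M : R[i]) : linear T -> (forall x, `|T x| <= M * `|x|) ->
  forall x, `|T x| <= (opnorm T)%:C * `|x|.
Proof.
move=> /linear_pack[f ->] fM x.
have [->|x0] := eqVneq x 0; first by rewrite linear0 !normr0 mulr0.
have nx0 : 0 < `|x| by rewrite normr_gt0.
have M0 : 0 <= M by rewrite -(pmulr_lge0 _ nx0) (le_trans _ (fM x)).
rewrite -ler_pdivrMr// mulrC -[X in X * _]ger0_norm ?invr_ge0//.
rewrite -normrZ -linearZ.
rewrite -[leLHS]RRe_real ?ger0_real// lecR; apply: ub_le_sup.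
  exists (complex.Re M) => _ [y /= y1 <-].
  have : `|f y| <= M by apply: le_trans (fM y) _; rewrite ler_piMr.
  by rewrite lecE => /andP[].
exists (`|x|^-1 *: x) => //=.
by rewrite normrZ ger0_norm ?invr_ge0// mulVf// gt_eqF.
Qed.

End HilbertOperators.

(** * Unitaries that permute and weight the coordinates *)

Section WeightedPermutation.
Variables (R : realType) (I : choiceType) (H : hilbertType R).
Local Notation l2 := (l2 I H).

(* The default value [0] of [insubd] is not reached when the [u m] are isometric
   and [s] is injective. *)
Definition weighted_perm (u : I -> H -> H) (s : I -> I) (f : l2) : l2 :=
  insubd (0 : l2) (fun n => u n (l2val f (s n))).

Lemma weighted_permE (u : I -> H -> H) (s : I -> I) (f : l2) n :
  (forall m x, `|u m x| = `|x|) -> injective s ->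
  l2val (weighted_perm u s f) n = u n (l2val f (s n)).
Proof.
move=> uN s_inj; rewrite [l2val _](insubdK _)//.
have [M fM] := l2P f; apply/asboolP; exists M => A.
apply: le_trans (fM (s @` A)%fset); rewrite /psum big_imfset/=; last first.
  by move=> i j _ _; exact: s_inj.
by apply: ler_sum => i _; rewrite !inner_norm uN.
Qed.

(** Allows sums over [I] to be reindexed along [s]: a finite set containing the image of [B] under
    [t] is sent by [s] to one containing [B]. *)
Lemma totally_imfset (s t : I -> I) : cancel t s ->
  (fun A : {fset I} => (s @` A)%fset) @ totally --> totally.
Proof.
move=> ts X [B _ BX]; exists (t @` B)%fset => //= A /fsubsetP tBA.
apply: BX; apply/fsubsetP => i iB; apply/imfsetP; exists (t i) => //=.
by apply: tBA; apply/imfsetP; exists i.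
Qed.

Variables (u v : I -> H -> H) (s t : I -> I).
Hypotheses (u_lin : forall n, linear (u n)) (uv : forall n, adjoint (u n) (v n)).
Hypotheses (uK : forall n, cancel (u n) (v n)) (vK : forall n, cancel (v n) (u n)).
Hypotheses (sK : cancel s t) (tK : cancel t s).

Let u_norm n x : `|u n x| = `|x|.
Proof. by apply/eqP; rewrite -(@eqrXn2 _ 2)// -!inner_norm uv uK. Qed.

Let v_norm n x : `|v n x| = `|x|.
Proof. by rewrite -{2}(vK n x) u_norm. Qed.

Lemma weighted_perm_unitary : unitary_op (weighted_perm u s).
Proof.
(* Solving [g n = u n (f (s n))] for [f] gives [f n = v (t n) (g (t n))]. *)
pose V := weighted_perm (fun n => v (t n)) t.
have uE f n := @weighted_permE u s f n u_norm (can_inj sK).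
have vE f n : l2val (V f) n = v (t n) (l2val f (t n)).
  by apply: weighted_permE => [m x|]; [exact: v_norm|exact: can_inj tK].
have adj : adjoint (weighted_perm u s) V.
  move=> f g; apply: l2dot_lim.
  rewrite (_ : psum _ _ = psum f (V g) \o (fun A => s @` A)%fset).
    exact: cvg_comp (totally_imfset tK) (l2dot_cvg (l2P f) (l2P (V g))).
  apply/funext => A; rewrite /= /psum big_imfset/=; last first.
    by move=> i j _ _; exact: can_inj sK _ _.
  by apply: eq_bigr => i _; rewrite uE vE !sK uv.
have lin : linear (weighted_perm u s).
  move=> c f g; apply/val_inj/funext => n; rewrite [LHS]uE.
  rewrite -[RHS]/(c *: l2val (weighted_perm u s f) n
                  + l2val (weighted_perm u s g) n) !uE.
  exact: u_lin.
have VK : cancel (weighted_perm u s) V.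
  by move=> f; apply/val_inj/funext => n; rewrite [LHS]vE uE uK tK.
split; last first.
  exists V; split=> //; apply/funext => f; first exact: VK.
  by apply/val_inj/funext => n; rewrite [LHS]uE vE sK vK.
split=> //; apply: (@lipschitz_continuous _ _ _ _ 1) => // f.
rewrite mul1r le_eqVlt; apply/orP; left.
by rewrite -(@eqrXn2 _ 2)// -!inner_norm adj VK.
Qed.

End WeightedPermutation.

(** * Compression by an isometry *)

Section Compression.
Variables (R : realType) (H K : hilbertType R) (W : H -> K) (Wt : K -> H).
Hypothesis W_lin : linear W.
Hypothesis W_adj : forall x y, inner (W x) y = inner x (Wt y).
Hypothesis WK : cancel W Wt.

Let W_norm x : `|W x| = `|x|.
Proof. by apply/eqP; rewrite -(@eqrXn2 _ 2)// -!inner_norm W_adj WK. Qed.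

Let Wt_lin : linear Wt.
Proof.
move=> c x y; apply: inner_inj => z.
by rewrite innerDr innerZr -!W_adj innerDr innerZr.
Qed.

Let Wt_norm y : `|Wt y| <= 1 * `|y|.
Proof.
rewrite mul1r; have [->|Wy0] := eqVneq (Wt y) 0; first by rewrite normr0.
have Wy_gt0 : 0 < `|Wt y| by rewrite normr_gt0.
rewrite -(ler_pM2r Wy_gt0) -expr2 -inner_norm -W_adj.
rewrite -[leLHS]ger0_norm; last by rewrite W_adj inner_ge0.
by apply: le_trans (inner_le_norm _ _) _; rewrite W_norm mulrC.
Qed.

Lemma compression_ucp (M : set (K -> K)) : M `<=` @bounded_op R K ->
  ucp M (fun T => Wt \o T \o W).
Proof.
move=> MB; split.
- move=> T /MB[lT cT]; split.
    by move=> c x y; rewrite /= W_lin lT Wt_lin.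
  have cW : continuous W.
    by apply: (@lipschitz_continuous _ _ _ _ 1) => // x; rewrite W_norm mul1r.
  have cWt : continuous Wt := lipschitz_continuous ler01 Wt_lin Wt_norm.
  move=> x; apply: continuous_comp; first exact: cW.
  by apply: continuous_comp; [exact: cT|exact: cWt].
- by move=> c S T _ _; apply/funext => x; rewrite /= !fctE Wt_lin.
- by apply/funext => x; exact: WK.
(* Since [Wt] is the adjoint of [W], the compressed form at [x] is the original form at [W \o x]. *)
move=> n T _ Tpos x; have := Tpos (W \o x).
by under eq_bigr do under eq_bigr do rewrite /= innerC W_adj -innerC.
Qed.

End Compression.

(** * Conjugation by words in almost commuting unitaries *)

Section Expi.
Variable R : realType.
Implicit Types a b : R.

Lemma expiD a b : expi (a + b) = expi a * expi b.
Proof.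
by rewrite /expi cosD sinD; apply/eqP; rewrite eq_complex/= eqxx/= addrC.
Qed.

Lemma expi0 : expi 0 = 1 :> R[i].
Proof. by rewrite /expi cos0 sin0. Qed.

Lemma conj_expi a : (expi a)^*%R = expi (- a).
Proof. by rewrite /expi cosN sinN. Qed.

Lemma expiNK a : expi (- a) * expi a = 1.
Proof. by rewrite -expiD addNr expi0. Qed.

Lemma norm_expi a : `|expi a| = 1.
Proof. by rewrite normc_def/= cos2Dsin2 sqrtr1. Qed.
End Expi.

Section Words.
Variables (R : realType) (H : hilbertType R) (d : nat).
Variables (U W : 'I_d -> H -> H).
Hypotheses (U_lin : forall j, linear (U j)) (UW : forall j, adjoint (U j) (W j)).
Hypotheses (UK : forall j, cancel (U j) (W j)) (WK : forall j, cancel (W j) (U j)).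
Implicit Types (s t : seq 'I_d) (x y : H).

Definition word s : H -> H := foldr (fun j T => U j \o T) id s.
(** The factors are composed in reverse order, which makes this the adjoint of [word s]. *)
Definition word_adj s : H -> H := foldr (fun j T => T \o W j) id s.

Lemma word_cat s t x : word (s ++ t) x = word s (word t x).
Proof. by elim: s => //= j s ->. Qed.

Lemma word_adj_cat s t x : word_adj (s ++ t) x = word_adj t (word_adj s x).
Proof. by elim: s x => //= j s IH x; rewrite IH. Qed.

Lemma word_linear s : linear (word s).
Proof. by elim: s => //= j s IH c x y; rewrite /= IH U_lin. Qed.

Lemma word_adjoint s : adjoint (word s) (word_adj s).
Proof. by elim: s => //= j s IH x y; rewrite /= UW IH. Qed.

Lemma wordK s : cancel (word s) (word_adj s).
Proof. by elim: s => //= j s IH x; rewrite /= UK IH. Qed.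

Lemma word_adjK s : cancel (word_adj s) (word s).
Proof. by elim: s => //= j s IH x; rewrite /= IH WK. Qed.

Lemma norm_word s x : `|word s x| = `|x|.
Proof.
by apply/eqP; rewrite -(@eqrXn2 _ 2)// -!inner_norm word_adjoint wordK.
Qed.

Lemma norm_word_adj s x : `|word_adj s x| = `|x|.
Proof. by rewrite -(norm_word s) word_adjK. Qed.

Variables (Theta : 'M[R]_d) (delta : R).
Hypothesis hcomm : almost_theta_commuting Theta delta U.

Lemma almost_commute j i x :
  `|expi (Theta j i) *: U j (U i x) - U i (U j x)| <= delta%:C * `|x|.
Proof.
have UN k y : `|U k y| = `|y| by exact: (norm_word [:: k] y).
rewrite -normrN opprB.
pose T := (U i \o U j) - expi (Theta j i) *: (U j \o U i).
have lT : linear T.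
  move=> c y z; rewrite /T !fctE /= !U_lin !scalerDr !scalerN !scalerA.
  by rewrite opprD addrACA [c * _]mulrC.
(* The constant [2] is an a priori bound from two isometric terms, required only for [opnorm T] to
   be a true supremum. *)
apply: le_trans (@le_opnorm _ _ T 2 lT _ x) _.
  move=> y; apply: le_trans (ler_normB _ _) _.
  by rewrite normrZ norm_expi mul1r /= !UN mulr_natl mulr2n.
by apply: ler_wpM2r => //; rewrite lecR; exact: hcomm.
Qed.

(** Induction peels off the outermost letter [j]: the inner word is treated underneath the isometry
    [U j], and exchanging [U j] with [U i] costs one further [delta]. *)
Lemma word_commute i s x :
  `|expi (\sum_(j <- s) Theta j i) *: word s (U i (word_adj s x)) - U i x| <=
  (delta * (size s)%:R)%:C * `|x|.
Proof.
elim: s x => [|j s IH] x /=.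
  by rewrite big_nil expi0 scale1r subrr normr0 mulr0 mul0r.
rewrite big_cons expiD -scalerA.
(* The difference is telescoped through the vector in which only the inner word has been
   cancelled. *)
rewrite -(subrKA (expi (Theta j i) *: U j (U i (W j x)))).
rewrite mulrSr mulrDr mulr1 rmorphD mulrDl.
apply: le_trans (ler_normD _ _) _; apply: lerD.
  have [f Uf] := linear_pack (U_lin j).
  rewrite -scalerBr normrZ norm_expi mul1r Uf -linearZ -linearB -Uf.
  rewrite -(norm_word_adj [:: j] x) (norm_word [:: j]).
  exact: IH.
rewrite -[in U i x](WK j x) -(norm_word_adj [:: j] x).
exact: almost_commute.
Qed.

End Words.

(** * Theta-commuting unitaries and their compression *)

Section Torus.
Variables (R : realType) (d : nat) (Theta : 'M[R]_d) (H : hilbertType R).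
Variables (U W : 'I_d -> H -> H).
Hypotheses (U_lin : forall j, linear (U j)) (UW : forall j, adjoint (U j) (W j)).
Hypotheses (UK : forall j, cancel (U j) (W j)) (WK : forall j, cancel (W j) (U j)).
Hypothesis hTheta : Theta^T = - Theta.
Local Notation lattice := {ffun 'I_d -> int}.
Implicit Types (i j k l : 'I_d) (n : lattice).

Definition below i : seq 'I_d := take i (enum 'I_d).

Definition phase i n : R := \sum_(j <- below i) Theta j i * (n j)%:~R.

(* The last coordinate does not move: [U i] for the last [i] acts in the fibres,
   so that its compression to a box has no boundary term. *)
Definition translate i (c : int) n : lattice :=
  if (i.+1 == d)%N then n else [ffun j => n j + c *+ (j == i)].

Definition on_last i (T : H -> H) : H -> H := if (i.+1 == d)%N then T else id.

Definition torus_weight i n x := expi (phase i n) *: on_last i (U i) x.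

Definition torus i : l2 lattice H -> l2 lattice H :=
  weighted_perm (torus_weight i) (translate i (-1)).

Lemma mem_below i j : (j \in below i) = (j < i)%N.
Proof. by rewrite in_take ?mem_enum// index_enum_ord. Qed.

Lemma phase_translate i j n : phase i (translate j (-1) n) =
  phase i n - (if (j < i)%N then Theta j i else 0).
Proof.
(* For the last index [j] nothing moves, in agreement with the formula because no [i] exceeds
   [j]. *)
rewrite /phase /translate; case: ifPn => [/eqP jd|jd].
  rewrite ifF ?subr0//; apply/negbTE; rewrite -leqNgt.
  by have := ltn_ord i; rewrite -{2}jd ltnS.
rewrite (eq_bigr (fun k => Theta k i * (n k)%:~R -
  (if k == j then Theta j i else 0))); last first.
  move=> k _; rewrite ffunE rmorphD/= mulrDr; congr (_ + _).
  by case: eqP => [->|_]; rewrite ?mulr1n ?mulr0n ?mulr0 ?oppr0//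
    rmorphN mulrN mulr1.
rewrite sumrB -big_mkcond/= -mem_below; congr (_ - _).
case: ifPn => jb; last first.
  by rewrite big_seq_cond big1// => k /andP[kb /eqP kj]; rewrite -kj kb in jb.
rewrite -big_filter (filter_pred1_uniq (take_uniq _ (enum_uniq _)) jb).
by rewrite big_seq1.
Qed.

Lemma translateK i (c : int) : cancel (translate i c) (translate i (- c)).
Proof.
move=> n; rewrite /translate; case: (i.+1 == d) => //; apply/ffunP => j.
by rewrite !ffunE mulNrn addrK.
Qed.

Lemma translateC i j (c e : int) n :
  translate i c (translate j e n) = translate j e (translate i c n).
Proof.
rewrite /translate; case: (i.+1 == d); case: (j.+1 == d) => //.
by apply/ffunP => k; rewrite !ffunE addrAC.
Qed.

Lemma torusE i f n : l2val (torus i f) n =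
  expi (phase i n) *: on_last i (U i) (l2val f (translate i (-1) n)).
Proof.
apply: weighted_permE => [m x|]; last first.
  exact: can_inj (@translateK i (-1)).
rewrite normrZ norm_expi mul1r /on_last; case: ifP => // _.
exact: (norm_word UW UK [:: i] x).
Qed.

Lemma torus_unitary i : unitary_op (torus i).
Proof.
pose v i n x := expi (- phase i n) *: on_last i (W i) x.
apply: (@weighted_perm_unitary _ _ _ _ (v i) _ (translate i 1)).
- move=> n c x y; rewrite /torus_weight /on_last.
  by case: ifP => _; rewrite ?U_lin scalerDr !scalerA mulrC.
- move=> n x y; rewrite /torus_weight /v innerZl innerZr conj_expi opprK.
  by congr (_ * _); rewrite /on_last; case: (i.+1 == d); rewrite ?UW.
- move=> n x; rewrite /torus_weight /v /on_last; case: ifP => _.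
    have [V WV] := linear_pack (adjoint_linear (UW i)).
    by rewrite WV linearZ -WV UK scalerA expiNK scale1r.
  by rewrite scalerA expiNK scale1r.
- move=> n x; rewrite /torus_weight /v /on_last.
  have e : expi (phase i n) * expi (- phase i n) = 1.
    by rewrite mulrC expiNK.
  case: ifP => _; last by rewrite scalerA e scale1r.
  have [V UV] := linear_pack (U_lin i).
  by rewrite UV linearZ -UV WK scalerA e scale1r.
- by rewrite -[X in cancel _ (translate i X)]opprK; exact: translateK.
- exact: translateK.
Qed.

(** Of the two phases only the one with the larger index feels the other translation. This produces
    [Theta k l] or [- Theta l k], which agree by antisymmetry. *)
Lemma torus_commuting : theta_commuting Theta torus.
Proof.
have anti k l : Theta l k = - Theta k l.
  by have := congr1 (fun M : 'M[R]_d => M k l) hTheta; rewrite !mxE.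
move=> k l; apply/funext => f; apply/val_inj/funext => n.
rewrite [LHS]torusE torusE.
rewrite -[RHS]/(expi (Theta k l) *: l2val (torus k (torus l f)) n) !torusE.
have [->|kl] := eqVneq k l.
  (* Antisymmetry makes the diagonal of [Theta] vanish. *)
  have : Theta l l *+ 2 == 0 by rewrite mulr2n {1}anti addNr.
  by rewrite mulrn_eq0/= => /eqP ->; rewrite expi0 scale1r.
rewrite translateC; set x := l2val f _.
have onZ i (c : R[i]) y : on_last i (U i) (c *: y) = c *: on_last i (U i) y.
  rewrite /on_last; case: ifP => // _.
  by have [V ->] := linear_pack (U_lin i); rewrite linearZ.
(* The indices differ, so at most one is the last, and the fibre operators commute because one of
   them is the identity. *)
have -> : on_last l (U l) (expi (phase k (translate l (-1) n)) *: on_last k (U k) x)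
  = expi (phase k (translate l (-1) n)) *: on_last k (U k) (on_last l (U l) x).
  rewrite onZ /on_last; case: ifP => //; case: ifP => // /eqP kd /eqP ld.
  by case/eqP: kl; apply/val_inj/succn_inj; rewrite kd ld.
rewrite onZ !scalerA -!expiD !phase_translate; congr (expi _ *: _).
case: (ltngtP k l) => [kl'|lk|/val_inj kl']; last by rewrite kl' eqxx in kl.
- by ring.
- by rewrite (anti k l); ring.
Qed.

End Torus.

(** * Counting and averaging over a discrete box *)

Section BoxSums.
Variables (N d : nat).
Hypothesis N_gt0 : (0 < N)%N.
Local Notation box := {ffun 'I_d -> 'I_N}.

(** The sum factors over the coordinates: [i] contributes the sum of [g], every other coordinate
    contributes [N]. The extra factor [N] avoids the exponent [d - 1]. *)
Lemma sum_box (g : nat -> nat) (i : 'I_d) :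
  (N * \sum_(b : box) g (b i) = N ^ d * \sum_(t < N) g t)%N.
Proof.
pose F (j : 'I_d) (t : 'I_N) := if j == i then g t else 1%N.
have -> : (\sum_(b : box) g (b i) = \sum_(b : box) \prod_j F j (b j))%N.
  apply: eq_bigr => b _; rewrite (bigD1 i)//= /F eqxx big1 ?muln1// => j.
  by move=> /negbTE ->.
rewrite -(bigA_distr_bigA F) (bigD1 i)//= mulnA [(N * _)%N]mulnC -mulnA mulnC.
congr (_ * _)%N; last by apply: eq_bigr => t _; rewrite /F eqxx.
rewrite (eq_bigr (fun=> N)); last first.
  by move=> j /negbTE ji; rewrite /F ji sum1_card card_ord.
rewrite -[in RHS](card_ord d) -prod_nat_const [RHS](bigD1 i)//.
Qed.

Lemma count_box (i : 'I_d) :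
  (N * \sum_(b : box) (b i == 0%N :> nat) = N ^ d)%N.
Proof.
rewrite (sum_box (fun t => t == 0%N)) (bigD1 (Ordinal N_gt0))//= big1 ?muln1//.
by move=> t; rewrite -val_eqE/= => /negbTE ->.
Qed.

Lemma mean_box (i : 'I_d) :
  (2 * \sum_(b : box) b i = N ^ d * N.-1)%N.
Proof.
apply/eqP; rewrite -(eqn_pmul2l N_gt0) mulnCA (sum_box id).
rewrite mulnCA [X in _ == X]mulnCA; apply/eqP; congr muln.
elim: N => [|m IH]; first by rewrite big_ord0.
by rewrite big_ord_recr/= mulnDr IH; case: m {IH} => //= m; lia.
Qed.

End BoxSums.

(** * Compression of the commuting tuple to the box *)

Section CompressedTorus.
Variables (R : realType) (d : nat) (Theta : 'M[R]_d) (H : hilbertType R).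
Variables (U W : 'I_d -> H -> H).
Hypotheses (U_lin : forall j, linear (U j)) (UW : forall j, adjoint (U j) (W j)).
Hypotheses (UK : forall j, cancel (U j) (W j)) (WK : forall j, cancel (W j) (U j)).
Variables (N : nat) (delta : R).
Hypotheses (N_gt0 : (0 < N)%N) (delta_ge0 : 0 <= delta).
Hypothesis (hcomm : almost_theta_commuting Theta delta U).
Local Notation lattice := {ffun 'I_d -> int}.
Local Notation box := {ffun 'I_d -> 'I_N}.
Implicit Types (i j : 'I_d) (n : lattice) (b : box) (s t : seq 'I_d).

(** Spells a product of powers as a list of letters. Absolute values are harmless, as the words
    matter only at box points, whose coordinates are nonnegative. *)
Definition steps s n : seq 'I_d := flatten [seq nseq `|n j|%N j | j <- s].

Definition full_steps n := steps (take d.-1 (enum 'I_d)) n.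

Definition embed b : lattice := [ffun j => Posz (b j)].

Definition box_fset : {fset lattice} := seq_fset tt (map embed (enum {: box})).

Lemma embed_inj : injective embed.
Proof.
move=> b c /ffunP bc; apply/ffunP => j; apply/val_inj.
by have := bc j; rewrite !ffunE => -[].
Qed.

Lemma embed_box b : embed b \in box_fset.
Proof. by rewrite seq_fsetE map_f// mem_enum. Qed.

Lemma big_box (V : nmodType) (F : lattice -> V) :
  \sum_(n <- box_fset) F n = \sum_b F (embed b).
Proof.
rewrite (perm_big (map embed (enum {: box}))).
  by rewrite big_map big_enum.
apply: uniq_perm => [||n]; last by rewrite seq_fsetE.
  exact: fset_uniq.
by rewrite (map_inj_uniq embed_inj) enum_uniq.
Qed.

Lemma translate_box i b : (i.+1 == d) || (b i != 0%N :> nat) ->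
  translate i (-1) (embed b) \in box_fset.
Proof.
rewrite /translate; case: ifP => [_ _|_ /= bi]; first exact: embed_box.
(* The truncated subtraction is exact because [b i] is nonzero. *)
pose c : box := [ffun j =>
  Ordinal (leq_ltn_trans (leq_subr (j == i) (b j)) (ltn_ord (b j)))].
rewrite (_ : [ffun j => _] = embed c); first exact: embed_box.
apply/ffunP => j; rewrite !ffunE /=; case: eqP => [->|_] /=.
  by move: bi; case: (nat_of_ord (b i)) => // m _; rewrite subn1 mulr1n /=; lia.
by rewrite mulr0n addr0 subn0.
Qed.

Lemma steps_cat s t n : steps (s ++ t) n = steps s n ++ steps t n.
Proof. by rewrite /steps map_cat flatten_cat. Qed.

Lemma take_enum_split i : i.+1 != d ->
  exists2 t, take d.-1 (enum 'I_d) = below i ++ i :: t & i \notin t.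
Proof.
move=> id; have i_lt : (i.+1 < d)%N by rewrite ltn_neqAle id ltn_ord.
have E : drop i (enum 'I_d) = i :: drop i.+1 (enum 'I_d).
  by rewrite (drop_nth i) ?size_enum_ord// nth_ord_enum.
exists (take (d.-1 - i).-1 (drop i.+1 (enum 'I_d))).
  rewrite /below -[in LHS](@subnKC i d.-1); last by lia.
  rewrite takeD E; congr (_ ++ _).
  by rewrite -[in LHS](@prednK (d.-1 - i)) //; lia.
have : uniq (take i (enum 'I_d) ++ drop i (enum 'I_d)).
  by rewrite cat_take_drop enum_uniq.
rewrite E cat_uniq => /and3P[_ _ /andP[+ _]]; apply: contra; exact: mem_take.
Qed.

(** For [i] not last, the letters after [i] cancel, and so do the powers of [U i] except for one:
    the left word has one more letter [i] than the right one. For the last [i], the full word is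
    already the word below [i], and [on_last] supplies [U i]. *)
Lemma word_full_translate i b x : translate i (-1) (embed b) \in box_fset ->
  word U (full_steps (embed b))
    (on_last i (U i) (word_adj W (full_steps (translate i (-1) (embed b))) x)) =
  word U (steps (below i) (embed b))
    (U i (word_adj W (steps (below i) (embed b)) x)).
Proof.
rewrite /on_last /translate; case: ifPn => [/eqP id _|id].
  by rewrite /full_steps /below -[in d.-1]id.
rewrite seq_fsetE => /mapP[c _ bc].
have bi : b i = (c i).+1 :> nat.
  move/ffunP/(_ i): bc; rewrite !ffunE eqxx mulr1n => /eqP.
  by rewrite subr_eq -PoszD => /eqP[->]; rewrite addn1.
have [t mt it] := take_enum_split id.
rewrite /full_steps mt !steps_cat /steps /= -!/(steps _ _) !ffunE eqxx mulr1n bi.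
set n' := [ffun j => _].
have same s : i \notin s -> steps s n' = steps s (embed b).
  move=> si; congr flatten; apply/eq_in_map => j js; rewrite ffunE.
  by case: eqP => [ji|_]; [rewrite -ji js in si|rewrite mulr0n addr0].
rewrite !same//; last by rewrite mem_below ltnn.
rewrite [absz (Posz (c i).+1)]/= (_ : `|_ - 1|%N = c i); last by lia.
rewrite word_cat /= word_cat !word_adj_cat.
by rewrite (word_adjK WK) (word_adjK WK).
Qed.

Lemma phase_steps i b :
  phase Theta i (embed b) = \sum_(j <- steps (below i) (embed b)) Theta j i.
Proof.
rewrite /phase /steps big_flatten big_map; apply: eq_bigr => j _.
by rewrite big_nseq ffunE iter_addr_0 -mulr_natr.
Qed.

Lemma size_steps s b : size (steps s (embed b)) = (\sum_(j <- s) b j)%N.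
Proof.
rewrite /steps size_flatten /shape -map_comp sumnE big_map.
by apply: eq_bigr => j _; rewrite /= size_nseq ffunE.
Qed.

Let a : R[i] := sqrtC (N ^ d)%:R^-1.

Let a_ge0 : 0 <= a.
Proof. by rewrite sqrtC_ge0 invr_ge0 ler0n. Qed.

Let a_conj : a^*%R = a.
Proof. by rewrite conj_Creal// ger0_real. Qed.

Let aa : a * a = (N ^ d)%:R^-1.
Proof. by rewrite -expr2 sqrtCK. Qed.

Let Nd_neq0 : (N ^ d)%:R != 0 :> R[i].
Proof. by rewrite pnatr_eq0 -lt0n expn_gt0 N_gt0. Qed.

(** The isometry of the compression, not to be confused with [W], which here is the family of
    adjoints of [U]; [gather] is its adjoint. *)
Definition spread (x : H) : l2 lattice H :=
  l2fin box_fset (fun n => a *: word_adj W (full_steps n) x).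

Definition gather (f : l2 lattice H) : H :=
  a *: \sum_(n <- box_fset) word U (full_steps n) (l2val f n).

Lemma spread_linear : linear spread.
Proof.
move=> c x y; apply/val_inj/funext => n.
rewrite -[RHS]/(
  c *: (if n \in box_fset then a *: word_adj W (full_steps n) x else 0) +
  (if n \in box_fset then a *: word_adj W (full_steps n) y else 0)) /=.
case: ifP => _; last by rewrite scaler0 addr0.
rewrite (adjoint_linear (word_adjoint UW (full_steps n))).
by rewrite scalerDr !scalerA mulrC.
Qed.

Lemma spread_adjoint x f : inner (spread x) f = inner x (gather f).
Proof.
rewrite innerC [inner f _]l2form_finr /psum rmorph_sum /=.
rewrite innerZr a_conj (linear_sumr _ x) mulr_sumr; apply: eq_bigr => n _.
rewrite -innerC innerZl; congr (_ * _).
by rewrite innerC -(word_adjoint UW) -innerC.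
Qed.

(** Writes [x] as an average over the box, so that it can be subtracted term by term from the
    compressed operator. *)
Lemma sum_const_box (x : H) : x = (a * a) *: \sum_(b : box) x.
Proof.
rewrite sumr_const card_ffun !card_ord -scaler_nat scalerA aa mulVf//.
by rewrite scale1r.
Qed.

Lemma spreadK : cancel spread gather.
Proof.
move=> x; rewrite /gather [RHS]sum_const_box -scalerA; congr (_ *: _).
rewrite scaler_sumr big_box; apply: eq_bigr => b _ /=.
rewrite embed_box.
have [f Ef] := linear_pack (word_linear U_lin (full_steps (embed b))).
by rewrite Ef linearZ -Ef (word_adjK WK).
Qed.

(** The first sum counts the terms lost at the boundary of the box, the second the letters that
    [U i] is moved through. *)
Definition spread_error i : R :=
  ((\sum_(b : box) ((i.+1 != d) && (b i == 0%N :> nat) : nat))%:R +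
   delta * (\sum_(b : box) \sum_(j <- below i) b j)%:R) / (N ^ d)%:R.

Lemma gather_torus_spread i x :
  `|gather (torus Theta U i (spread x)) - U i x| <= (spread_error i)%:C * `|x|.
Proof.
(* The contribution of [b] to the average; it vanishes when the translated point leaves the box,
   outside which [spread] is zero. *)
pose E (b : box) := if translate i (-1) (embed b) \in box_fset then
  expi (phase Theta i (embed b)) *: word U (steps (below i) (embed b))
    (U i (word_adj W (steps (below i) (embed b)) x)) else 0.
have -> : gather (torus Theta U i (spread x)) = (a * a) *: \sum_b E b.
  rewrite /gather -scalerA; congr (_ *: _).
  rewrite scaler_sumr big_box; apply: eq_bigr => b _.
  rewrite (torusE Theta UW UK) -[l2val (spread x) _]/(if
    translate i (-1) (embed b) \in box_fset then
    a *: word_adj W (full_steps (translate i (-1) (embed b))) x else 0) /E.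
  have [f Ef] := linear_pack (word_linear U_lin (full_steps (embed b))).
  case: ifPn => sb; last first.
    have -> : on_last i (U i) 0 = 0.
      have [g Eg] := linear_pack (U_lin i).
      by rewrite /on_last; case: ifP => // _; rewrite Eg linear0.
    by rewrite !(@scaler0 _ H) Ef linear0.
  have -> y : on_last i (U i) (a *: y) = a *: on_last i (U i) y.
    have [g Eg] := linear_pack (U_lin i).
    by rewrite /on_last; case: ifP => // _; rewrite Eg linearZ.
  by rewrite Ef !linearZ -Ef word_full_translate// !scalerA mulrC.
rewrite [X in _ - X]sum_const_box -scalerBr -sumrB normrZ ger0_norm ?mulr_ge0//.
rewrite aa mulrC ler_pdivrMr ?ltr0n ?expn_gt0 ?N_gt0//.
apply: le_trans (ler_norm_sum _ _ _) _.
apply: (@le_trans _ _ (\sum_(b : box)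
  ((((i.+1 != d) && (b i == 0%N :> nat)) : nat)%:R +
  delta * (\sum_(j <- below i) b j)%:R)%:C * `|x|)).
  apply: ler_sum => b _; rewrite /E; case: ifPn => sb.
    apply: le_trans (_ : _ <= (delta * (\sum_(j <- below i) b j)%:R)%:C * `|x|) _.
      rewrite phase_steps -size_steps.
      exact: (word_commute U_lin UW UK WK hcomm).
    by rewrite ler_wpM2r// lecR lerDr.
  (* A term is missing only if [i] is not last and [b i] is zero; its cost is [|U i x| = |x|]. *)
  have /negbTE/norP[-> /negPn ->] : ~~ ((i.+1 == d) || (b i != 0%N :> nat)).
    by apply: contra sb; exact: translate_box.
  rewrite sub0r normrN (norm_word UW UK [:: i]) ler_peMl// (lecR 1) lerDl.
  by rewrite mulr_ge0.
rewrite -mulr_suml mulrAC ler_wpM2r// -(rmorph_nat (real_complex R)) -rmorphM.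
rewrite divfK; last by rewrite pnatr_eq0 -lt0n expn_gt0 N_gt0.
by rewrite -rmorph_sum lecR big_split/= -mulr_sumr !natr_sum.
Qed.

End CompressedTorus.

(** * Evaluation of the error and choice of the box size *)

Lemma spread_errorE (R : realType) (d N : nat) (delta : R) (i : 'I_d) :
  (0 < N)%N -> spread_error N delta i =
  (if (i.+1 == d)%N then 0 else N%:R^-1) + delta * (i%:R * N.-1%:R / 2).
Proof.
move=> N_gt0; have N0 : N%:R != 0 :> R by rewrite pnatr_eq0 -lt0n.
have Nd0 : (N ^ d)%:R != 0 :> R by rewrite pnatr_eq0 -lt0n expn_gt0 N_gt0.
rewrite /spread_error mulrDl; congr (_ + _).
  case: eqP => [_|_]; first by rewrite big1 ?mul0r.
  apply: (mulfI N0); rewrite mulfV// mulrA -natrM.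
  by rewrite (count_box N_gt0) mulfV.
rewrite -mulrA; congr (_ * _); apply/eqP; rewrite eqr_div ?Nd0 ?pnatr_eq0//.
rewrite -!natrM eqr_nat exchange_big/= mulnC big_distrr/=.
rewrite (eq_bigr (fun=> N ^ d * N.-1)%N); last first.
  by move=> j _; exact: mean_box.
rewrite big_const_seq count_predT iter_addn_0 size_take size_enum_ord ltn_ord.
by apply/eqP; nia.
Qed.

(** The box size balances the two errors: [1 / N < s] controls the boundary, and [(N - 1) * s <= 1]
    turns [delta = s * s] into a multiple of [s]. *)
Lemma spread_error_lt (R : realType) (d : nat) (delta : R) (i : 'I_d) :
  (2 <= d)%N -> 0 < delta ->
  spread_error (Num.truncn (Num.sqrt delta)^-1).+1 delta i <
  (d%:R - 1) * Num.sqrt delta.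
Proof.
move=> d2 delta0; set s := Num.sqrt delta.
have s0 : 0 < s by rewrite sqrtr_gt0.
have ds : delta = s * s by rewrite -expr2 sqr_sqrtr// ltW.
set M := Num.truncn s^-1.
have /andP[Ms sM] : M%:R <= s^-1 < M.+1%:R.
  by apply: truncn_itv; rewrite invr_ge0 ltW.
have {}Ms : M%:R * s <= 1 by rewrite -ler_pdivlMr// div1r.
have {}sM : M.+1%:R^-1 < s by rewrite invf_plt ?posrE// ltr0n.
rewrite spread_errorE// ds -[M.+1.-1]/M.
have iM : s * s * (i%:R * M%:R / 2) <= s * i%:R / 2.
  rewrite (_ : _ * _ = s * i%:R / 2 * (M%:R * s)); last by field.
  by rewrite ler_piMr// !mulr_ge0// ltW.
have d2r : 2 <= d%:R :> R by rewrite (ler_nat _ 2).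
case: eqP => [id|/eqP id].
  have di : d%:R = i%:R + 1 :> R by rewrite natr1 id.
  (* For the last index there is no boundary term, and [s * i / 2 < i * s] because [i] is
     positive. *)
  rewrite di in d2r *; nra.
have di : i%:R + 2 <= d%:R :> R.
  by rewrite -natrD ler_nat addn2 ltn_neqAle id ltn_ord.
apply: lt_le_trans (ltr_leD sM iM) _; rewrite -subr_ge0.
(* Both fractions are nonnegative, by [i + 2 <= d] and [2 <= d]. *)
rewrite (_ : _ - _ = s * ((d%:R - i%:R - 2) / 2 + (d%:R - 2) / 2)); last by field.
by apply: mulr_ge0 (ltW s0) _; lra.
Qed.

(** * The commuting tuple and the distance bound *)

Theorem corollary3p4 (R : realType) (d : nat) (hd : (2 <= d)%N)
  (Theta : 'M[R]_d) (hTheta : Theta^T = - Theta)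
  (delta : R) (hdelta : 0 < delta)
  (H : hilbertType R) (hH : separable H)
  (U : 'I_d -> H -> H) (hU : unitary_tuple U)
  (hcomm : almost_theta_commuting Theta delta U) :
  exists (K : hilbertType R) (V : 'I_d -> K -> K),
    [/\ separable K, unitary_tuple V, theta_commuting Theta V &
        (drD U V < ((d%:R - 1) * Num.sqrt delta)%:E)%E].
Proof.
have U_lin j : linear (U j) := (hU j).1.1.
have [W hW] := choice (fun j => (hU j).2).
have UW j : adjoint (U j) (W j) by have [] := hW j.
have UK j : cancel (U j) (W j).
  by move=> x; have [_ + _] := hW j; move/(congr1 (@^~ x)).
have WK j : cancel (W j) (U j).
  by move=> x; have [_ _] := hW j; move/(congr1 (@^~ x)).
set N := (Num.truncn (Num.sqrt delta)^-1).+1.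
have VU : unitary_tuple (torus Theta U).
  by move=> j; exact: torus_unitary U_lin UW UK WK j.
exists (l2 {ffun 'I_d -> int} H : hilbertType R), (torus Theta U); split.
- exact: l2_separable.
- exact: VU.
- exact: torus_commuting U_lin UW UK hTheta.
pose Psi T : H -> H := gather U N \o T \o spread W N.
apply: (@le_lt_trans _ _ (tuple_norm (fun i => U i - Psi (torus Theta U i)))%:E).
  (* The infimum is estimated by one candidate: the identity representation on [H] together with the
     compression [Psi]. *)
  apply: ereal_inf_lbound; exists H, id, Psi; split=> //.
    split; split=> //.
    by apply: cstar_gen_bounded => j; exact: (hU j).1.
  apply: (compression_ucp (spread_linear UW N) (spread_adjoint UW N)).
    exact (@spreadK _ _ _ _ _ U_lin WK N (ltn0Sn _)).
  by apply: opsys_gen_bounded => j; exact: (VU j).1.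
(* The maximum starts from [0], so the bound itself must be shown positive, which follows from
   [2 <= d]. *)
rewrite lte_fin; apply/bigmax_ltP; split.
  rewrite mulr_gt0 ?sqrtr_gt0// subr_gt0 ltr1n.
  exact: hd.
move=> i _; apply: le_lt_trans (spread_error_lt i hd hdelta).
apply: opnorm_le => [|x].
  by rewrite /spread_error divr_ge0// addr_ge0// mulr_ge0// ltW.
rewrite fctE -normrN opprB.
exact: (gather_torus_spread U_lin UW UK WK (ltn0Sn _) (ltW hdelta) hcomm).
Qed.
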